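(* For each $G$-vertex-rotary Hall Cayley map $\mathcal{M}=\mathrm{CayM}(G,H,a,z)$ of $H$ defined by a rotary pair $(a,z)$, there exist infinitely many elementary abelian groups $V$ such that, for a semidirect product $X=V{:}G$, the map $\mathrm{CayM}(X,V{:}H,a,vz)$ is a cover of $\mathcal{M}$ for some $v\in V$.
   Context: All groups are finite. A map $\mathcal{M}$ is a cellular embedding of a connected graph (multiple edges allowed) in a closed surface, with vertex, edge and face sets having at least two vertices and at least two faces. For $G\le\mathrm{Aut}\,\mathcal{M}$, $\mathcal{M}$ is $G$-vertex-rotary if $G$ is transitive on arcs and vertex stabilizers in $G$ are cyclic. A rotary pair for $G$ is a pair $(a,z)$ with $G=\langle a,z\rangle$, $|z|=2$. Every $G$-vertex-rotary map arises from a rotary pair $(a,z)$: vertices are the cosets $[G:\langle a\rangle]$, edges the cosets $[G:\langle z\rangle]$, and the faces are either the cosets $[G:\langle az\rangle]$ (rotary map) or the cosets $[G:\langle z,z^a\rangle]$ (bi-rotary map); incidence is nonempty intersection. A $G$-vertex-rotary Hall Cayley map $\mathrm{CayM}(G,H,a,z)$ of $H$ is a $G$-vertex-rotary map defined by a rotary pair $(a,z)$ such that $H\le G$, $G=H\langle a\rangle$, $H\cap\langle a\rangle=1$, and $\gcd(|H|,|a|)=1$. For a $G$-vertex-rotary map $\mathcal{N}=(V,E,F)$ and a normal subgroup $L\lhd G$, the quotient map $\mathcal{N}_L$ has vertices, edges and faces the $L$-orbits on $V$, $E$, $F$ with the natural incidence, and $\mathcal{N}$ is called a cover of $\mathcal{N}_L$.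 $V{:}G$ denotes a semidirect product with normal subgroup $V$. *)

(* Defs.v *)
From HB Require Import structures.
From mathcomp Require Import all_boot all_order all_fingroup all_solvable.

Set Implicit Arguments.
Unset Strict Implicit.
Unset Printing Implicit Defensive.

Local Open Scope group_scope.

(* The cells of a map, with their incidence.  The three kinds of cells share   *)
(* an ambient type, but the same element may well be, e.g., both a vertex and  *)
(* a face; [inc] is only used on vertex/edge, vertex/face and edge/face pairs, *)
(* in that order.                                                              *)
Record cellmap (T : finType) := CellMap {
  verts : {set T};
  edges : {set T};
  faces : {set T};
  inc : rel T }.

Definition map_iso (T T' : finType) (M : cellmap T) (M' : cellmap T') : Prop :=
  exists fV fE fF : T -> T',
    [/\ {in verts M &, injective fV} /\ fV @: verts M = verts M',
        {in edges M &, injective fE} /\ fE @: edges M = edges M',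
        {in faces M &, injective fF} /\ fF @: faces M = faces M' &
        [/\ {in verts M & edges M,
              forall x e, inc M' (fV x) (fE e) = inc M x e},
            {in verts M & faces M,
              forall x f, inc M' (fV x) (fF f) = inc M x f} &
            {in edges M & faces M,
              forall e f, inc M' (fE e) (fF f) = inc M e f}]].

Definition adjacent (T : finType) (M : cellmap T) : rel T :=
  [rel x y | [&& x \in verts M, y \in verts M &
                 [exists e in edges M, inc M x e && inc M y e]]].

Section GroupActingOnMap.

Variables (aT : finGroupType) (T : finType).
Variables (G : {group aT}) (to : {action aT &-> T}) (M : cellmap T).

(* G is a subgroup of Aut M. *)
Definition acts_on_map : Prop :=
  [/\ [acts G, on verts M | to], [acts G, on edges M | to],
      [acts G, on faces M | to],
      [faithful G, on verts M :|: edges M :|: faces M | to] &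
      {in G, forall g x y, inc M (to x g) (to y g) = inc M x y}].

(* An arc is a vertex together with an edge at it: a connected graph with at   *)
(* least two vertices whose arcs are permuted transitively has no loops.       *)
Definition is_arc (x e : T) : bool :=
  [&& x \in verts M, e \in edges M & inc M x e].

Definition arc_transitive : Prop :=
  forall x e y f : T, is_arc x e -> is_arc y f ->
    exists2 g : aT, g \in G & to x g = y /\ to e g = f.

Definition vertex_rotary : Prop :=
  [/\ (1 < #|verts M|)%N /\ (1 < #|faces M|)%N,
      {in verts M &, forall x y, connect (adjacent M) x y},
      acts_on_map,
      arc_transitive &
      {in verts M, forall x, cyclic 'C_G[x | to]}].

End GroupActingOnMap.

Definition quotient_map (aT : finGroupType) (T : finType) (L : {group aT})
    (to : {action aT &-> T}) (M : cellmap T) : cellmap {set T} :=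
  CellMap [set orbit to L x | x in verts M]
          [set orbit to L e | e in edges M]
          [set orbit to L f | f in faces M]
          (fun O P => [exists x in O, exists y in P, inc M x y]).

Variant map_kind := Rotary | BiRotary.

Section CosetMaps.

Variable gT : finGroupType.
Implicit Types (k : map_kind) (G H L : {group gT}) (a z : gT).

Definition rotary_pair G a z : Prop := <<[set a; z]>> = G /\ #[z] = 2.

Definition face_stab k a z : {group gT} :=
  match k with
  | Rotary => <[a * z]>%G
  | BiRotary => <<[set z; z ^ a]>>%G
  end.

(* The cells are right cosets, on which G acts by right multiplication, i.e.,  *)
(* via 'Rs.  The surface embedding is determined by k, G, a and z; it is not   *)
(* recorded beyond the cells and their incidence by nonempty intersection,     *)
(* which in the bi-rotary case puts each edge on just one face.                *)
Definition coset_map k G a z : cellmap {set gT} :=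
  CellMap (rcosets <[a]> G) (rcosets <[z]> G) (rcosets (face_stab k a z) G)
          (fun A B => A :&: B != set0).

Definition hall_cayley_map k G H a z : Prop :=
  [/\ rotary_pair G a z,
      vertex_rotary G 'Rs (coset_map k G a z),
      H \subset G,
      H * <[a]> = G /\ H :&: <[a]> = 1 &
      coprime #|H| #[a]].

End CosetMaps.

(* For a map M acted on by X via [to], with L normal in X: M is a cover of M'  *)
(* in that its quotient by L is M'.                                            *)
Definition cover_by (xT : finGroupType) (T T' : finType) (X L : {group xT})
    (to : {action xT &-> T}) (M : cellmap T) (M' : cellmap T') : Prop :=
  L <| X /\ map_iso (quotient_map L to M) M'.

(* Main.v *)
Require Import Defs.
From mathcomp Require Import all_boot all_order all_fingroup all_solvable zmodp.

(** Choose a prime [p] larger than [N] and than [#|G|].  Over the group [G] of a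
    map with rotary pair [(a, z)], consider the regular wreath product of a
    cyclic group of order [p] by [gT], realised by the permutations
    [(h, i) |-> (h * g, i * c h)] of the product of [gT] with the cyclic group.
    Lift [a] with trivial voltages, and lift [z] with voltages that vanish
    except on the single edge joining the vertices of [1] and [z], traversed
    with opposite voltages [u] and [u^-1]; this makes the lift of [z] an
    involution.  The lifts [b] and [y] generate a group [X] that projects onto
    [G], with an elementary abelian [p]-group [V] as kernel.

    The crux is that [V] is nontrivial ([ker_projection_nontrivial]).  If [V]
    were trivial, the orbit of [(1, 1)] under [X] would contain at most one
    point over each [g], so the vertices lifted at height [1] would be
    separated from the others by the one edge that carries a voltage.  In an
    arc-transitive graph that is not a single edge there is no such bridge
    ([no_one_edge_cut]).  The hypothesis [a != 1] that this needs comes from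
    the map having at least two faces.

    Since [p] does not divide [#|G|], the Schur-Zassenhaus theorem provides a
    complement [K] of [V] in [X], and its conjugacy part allows [b] to be taken
    in [K] ([complement_containing]).  The inverse of the projection of [K] to
    [G] is the embedding [iota] ([complement_section]): it maps [a] to [b], and
    [v := y * (iota z)^-1] lies in [V] because [y] and [iota z] have the same
    projection.

    It remains to see that the objects so obtained are maps of the required
    kind.  A coset map of a rotary pair is always vertex-rotary once it has two
    vertices and two faces ([coset_map_vertex_rotary]), properties which [X]
    inherits from its quotient [G]; and taking the orbits of the kernel of an
    epimorphism carrying one rotary pair to another turns the first coset map
    into the second ([coset_map_cover]). *)

Local Open Scope group_scope.

Set Implicit Arguments.
Unset Strict Implicit.

(** * Bridges in arc-transitive graphs *)

Section OneEdgeCut.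
Variables (gT : finGroupType) (a z : gT).
Hypotheses (a_neq1 : a != 1) (zz1 : z * z = 1).

(** Here [A] is a set of arcs closed under rotation about vertices, with a
    single boundary edge, joining [1] to [z].  Two such cuts can be uncrossed:
    the arcs of [A] beyond the boundary edge of the translate [a *: A] form
    again such a set, up to translation, and it is smaller as [1] is not in it.
    Hence there is no minimal one.  If [a = 1] the graph is a single edge, which
    is a bridge. *)
Lemma no_one_edge_cut (A : {set gT}) :
    1 \in A -> z \notin A -> (forall g, (g * a \in A) = (g \in A)) ->
  ~ (forall g, g \in A -> g != 1 -> g * z \in A).
Proof.
have [n leAn] := ubnP #|A|; elim: n A leAn => // n IHn A leAn A1 A'z Aa Az.
have A_a : a \in A by rewrite -[a]mul1g Aa.
have A_aV : a^-1 \in A by rewrite -Aa mulVg.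
(* The translate of A :\: (a *: A) which moves the boundary arc a * z to 1. *)
pose B := [set g | (a * z * g \in A) && (z * g \notin A)].
apply: (IHn B).
- rewrite -ltnS; apply: leq_trans leAn; rewrite ltnS -(card_lcoset B (a * z)).
  apply/proper_card/properP; split.
    by apply/subsetP=> _ /lcosetP[g /[!inE] /andP[Ag _] ->].
  exists 1 => //; apply/negP=> /lcosetP[g /[!inE] /andP[_ Bg] def1].
  by case/negP: Bg; rewrite -(mulKg a (z * g)) (mulgA a) -def1 mulg1.
- by rewrite inE !mulg1 A'z Az.
- by rewrite inE zz1 A1 andbF.
- by move=> g; rewrite !inE !mulgA !Aa.
move=> g /[!inE] /andP[Ag A'g] g_neq1; rewrite !mulgA Az //=; last first.
  apply: contraNneq A'g => def1.
  by rewrite -(mulKg a (z * g)) (mulgA a) def1 mulg1.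
apply: contra A'g => Agz.
rewrite -[z * g]mulg1 -zz1 mulgA Az //.
apply: contraNneq g_neq1 => def1.
by rewrite -(mulKg z g) (canRL (mulgK z) def1) mul1g -invMg zz1 invg1.
Qed.

End OneEdgeCut.

(** * Coset maps of rotary pairs *)

Section CosetMapRotary.
Variables (gT : finGroupType) (k : map_kind) (G : {group gT}) (a z : gT).
Hypothesis rotG : rotary_pair G a z.

Local Notation M := (coset_map k G a z).

Let defG : <<[set a; z]>> = G. Proof. by case: rotG. Qed.

Lemma rotary_pair_mem : a \in G /\ z \in G.
Proof. by rewrite -defG !mem_gen // !inE eqxx ?orbT. Qed.
Let Ga := proj1 rotary_pair_mem.
Let Gz := proj2 rotary_pair_mem.

Lemma rotary_pair_sub (K : {group gT}) : a \in K -> z \in K -> G \subset K.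
Proof.
move=> Ka Kz; have -> : G :=: <<[set a; z]>> by rewrite defG.
by rewrite gen_subG; apply/subsetP=> x /set2P[]->.
Qed.

(** Right multiplication preserves adjacency, so the [x] for which [<[a]> :* x]
    is connected to [<[a]>] form a subgroup; it contains [a], which fixes the
    vertex [<[a]>], and [z], as [<[a]> :* z] is the other end of [<[z]>]. *)
Lemma adjacent_connected : {in verts M &, forall x y, connect (adjacent M) x y}.
Proof.
have adjM g x y : g \in G -> adjacent M x y -> adjacent M (x :* g) (y :* g).
  move=> Gg /and3P[/rcosetsP[r Gr ->] /rcosetsP[s Gs ->]].
  case/existsP=> _ /andP[/rcosetsP[t Gt ->] /andP[xt yt]].
  have inV u : u \in G -> <[a]> :* u :* g \in verts M.
    move=> Gu; rewrite -rcosetM; apply/rcosetsP.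
    by exists (u * g); rewrite ?groupM.
  apply/and3P; split; rewrite ?inV //; apply/existsP; exists (<[z]> :* t :* g).
  have incg u : inc M (<[a]> :* u) (<[z]> :* t) ->
      inc M (<[a]> :* u :* g) (<[z]> :* t :* g).
    case/set0Pn=> v /setIP[v1 v2]; apply/set0Pn; exists (v * g).
    by rewrite inE !(mem_rcoset _ g) !mulgK v1.
  rewrite !incg // !andbT -rcosetM.
  by apply/rcosetsP; exists (t * g); rewrite ?groupM.
have conM g x y : g \in G -> connect (adjacent M) x y ->
    connect (adjacent M) (x :* g) (y :* g).
  move=> Gg /connectP[p p_path ->] {y}.
  elim: p x p_path => [|y p IHp] x /=; first by rewrite connect0.
  case/andP=> xy p_path; apply: connect_trans (IHp _ p_path).
  by apply: connect1; apply: adjM.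
pose C := [set x in G | connect (adjacent M) <[a]> (<[a]> :* x)].
have C_group : group_set C.
  apply/group_setP; split=> [|x y]; first by rewrite inE group1 mulg1 connect0.
  rewrite !inE => /andP[Gx Cx] /andP[Gy Cy]; rewrite groupM //=.
  by apply: connect_trans Cy _; rewrite rcosetM conM.
have adj_az : adjacent M <[a]> (<[a]> :* z).
  apply/and3P; split.
  - by apply/rcosetsP; exists 1; rewrite ?mulg1.
  - by apply/rcosetsP; exists z.
  apply/existsP; exists <[z]>; apply/and3P; split.
  - by apply/rcosetsP; exists 1; rewrite ?mulg1.
  - by apply/set0Pn; exists 1; rewrite inE !group1.
  by apply/set0Pn; exists z; rewrite inE rcoset_refl cycle_id.
have sGC : G \subset Group C_group.
  apply: rotary_pair_sub; first by rewrite inE Ga rcoset_id ?cycle_id ?connect0.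
  by rewrite inE Gz connect1.
move=> _ _ /rcosetsP[x Gx ->] /rcosetsP[y Gy ->].
have /(subsetP sGC) : y * x^-1 \in G by rewrite groupM ?groupV.
rewrite inE => /andP[_ /(conM x _ _ Gx)].
by rewrite -rcosetM mulgKV.
Qed.

(** The elements of an arc are the two cosets of some [u], so the arcs form
    a single orbit of [G].  An element fixing all vertices and edges lies in
    [<[a]>] and [<[z]>]; these meet trivially, for otherwise [z \in <[a]>], so
    that [<[a]>] is all of [G] and there is only one vertex. *)
Lemma coset_map_vertex_rotary :
  (1 < #|verts M|)%N -> (1 < #|faces M|)%N -> vertex_rotary G 'Rs M.
Proof.
move=> V_gt1 F_gt1; split=> //.
- exact: adjacent_connected.
- split; try exact: actsRs_rcosets.
  + apply/subsetP=> g /setIP[Gg /astabP fixg].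
    have fix1 (K : {group gT}) :
        rcosets K G \subset verts M :|: edges M :|: faces M -> g \in K.
      move=> sKM; rewrite -(astab1Rs K); apply/astab1P/fixg.
      by apply: (subsetP sKM); apply/rcosetsP; exists 1; rewrite ?mulg1.
    have g_az : g \in <[z]> :&: <[a]>.
      rewrite inE !fix1 //; first by rewrite -setUA subsetUl.
      by rewrite -setUA setUCA subsetUl.
    rewrite -(_ : <[z]> :&: <[a]> = 1) //.
    apply: prime_TIg; first by rewrite -orderE (proj2 rotG).
    rewrite cycle_subG; apply: contraL V_gt1 => az.
    by rewrite [_ < _]indexg_gt1 negbK rotary_pair_sub ?cycle_id.
  + move=> g Gg x y /=; apply/set0Pn/set0Pn=> [] [u].
      rewrite /= !rcosetE inE !mem_rcoset => xyu.
      by exists (u * g^-1); rewrite inE.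
    case/setIP=> xu yu; exists (u * g).
    by rewrite /= !rcosetE inE !mem_rcoset mulgK xu.
- have arcP x e : is_arc M x e ->
      exists2 u, u \in G & x = <[a]> :* u /\ e = <[z]> :* u.
    case/and3P=> /rcosetsP[r Gr ->] /rcosetsP[s Gs ->] /set0Pn[u /setIP[ur us]].
    exists u; last by rewrite -(rcoset_eqP ur) -(rcoset_eqP us).
    case/rcosetP: ur => c ac ->.
    by rewrite groupM // (subsetP _ c ac) ?cycle_subG.
  move=> x e y f /arcP[u Gu [-> ->]] /arcP[v Gv [-> ->]].
  exists (u^-1 * v); rewrite ?groupM ?groupV //=.
  by rewrite !rcosetE -!rcosetM mulKVg.
move=> _ /rcosetsP[x Gx ->].
rewrite -rcosetE (astab1_act 'Rs) astab1Rs.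
by rewrite (cyclicS (subsetIr _ _)) // cyclicJ cycle_cyclic.
Qed.
End CosetMapRotary.

(** * Quotients of coset maps by kernels *)

Section QuotientCosetMap.
Variables (xT gT : finGroupType) (X : {group xT}) (phi : {morphism X >-> gT}).

Local Notation V := ('ker phi)%G.

(** An orbit of cells under the kernel is a set of cosets; the union of these is
    a full preimage, so taking its image under [phi] loses nothing. *)
Definition orbit_image (O : {set {set xT}}) : {set gT} := phi @* cover O.

Definition coset_orbits (K : {group xT}) : {set {set {set xT}}} :=
  [set orbit 'Rs V c | c in rcosets K X].

Lemma mem_ker_div x y : x \in X -> y \in X -> phi x = phi y -> y^-1 * x \in V.
Proof.
move=> Xx Xy eq_xy; apply/kerP; first by rewrite groupM ?groupV.
by rewrite morphM ?groupV // morphV // eq_xy mulVg.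
Qed.

Lemma coset_orbitsP (K : {group xT}) O :
  O \in coset_orbits K -> exists2 x, x \in X & O = orbit 'Rs V (K :* x).
Proof. by case/imsetP=> _ /rcosetsP[x Xx ->] ->; exists x. Qed.

Lemma orbit_image_coset (K : {group xT}) x :
  K \subset X -> x \in X ->
  orbit_image (orbit 'Rs V (K :* x)) = (phi @* K) :* phi x.
Proof.
move=> sKX Xx; have sKxX : K :* x \subset X by rewrite mul_subG ?sub1set.
have -> : orbit_image (orbit 'Rs V (K :* x)) = phi @* ((K :* x) * V).
  rewrite /orbit_image cover_imset; congr (phi @* _); apply/setP=> y.
  apply/bigcupP/mulsgP=> [[v Vv] | [u v Ku Vv ->]].
    by rewrite /= rcosetE => /rcosetP[u Ku ->]; exists u v.
  by exists v => //=; rewrite rcosetE mem_rcoset mulgK.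
by rewrite morphimMl // morphim_ker mulg1 morphimMl // morphim_set1.
Qed.

Lemma orbit_image_bij (K : {group xT}) :
  K \subset X ->
  {in coset_orbits K &, injective orbit_image} /\
  orbit_image @: coset_orbits K = rcosets (phi @* K) (phi @* X).
Proof.
move=> sKX; split.
  move=> _ _ /coset_orbitsP[x Xx ->] /coset_orbitsP[y Xy ->].
  rewrite !orbit_image_coset // => eq_xy; apply/orbit_eqP.
  have /rcosetP[_ /morphimP[h Xh Kh ->]] : phi x \in phi @* K :* phi y.
    by rewrite -eq_xy rcoset_refl.
  rewrite -morphM // => def_x; apply/imsetP; exists ((h * y)^-1 * x).
    by rewrite mem_ker_div ?groupM.
  by rewrite /= rcosetE -rcosetM invMg mulgA mulKVg rcosetM
    (rcoset_id (groupVr Kh)).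
apply/setP=> B; apply/imsetP/rcosetsP.
  case=> _ /coset_orbitsP[x Xx ->] ->; exists (phi x); rewrite ?mem_morphim //.
  exact: orbit_image_coset.
case=> _ /morphimP[x _ Xx ->] ->; exists (orbit 'Rs V (K :* x)).
  by apply: imset_f; apply/rcosetsP; exists x.
by rewrite orbit_image_coset.
Qed.

(** Cosets of [K] and [L] whose images meet have points with the same image;
    these differ by an element of the kernel, which moves one of the cosets so
    that it meets the other. *)
Lemma orbit_image_inc (K L : {group xT}) : K \subset X -> L \subset X ->
  {in coset_orbits K & coset_orbits L, forall O P,
     (orbit_image O :&: orbit_image P != set0)
       = [exists x in O, exists y in P, x :&: y != set0]}.
Proof.
move=> sKX sLX _ _ /coset_orbitsP[x Xx ->] /coset_orbitsP[y Xy ->].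
rewrite !orbit_image_coset //; apply/set0Pn/existsP.
  case=> _ /setIP[/rcosetP[_ /morphimP[g Xg Kg ->] ->]].
  case/rcosetP=> _ /morphimP[h Xh Lh ->]; rewrite -!morphM // => eq_gh.
  exists (K :* x); rewrite orbit_refl; apply/existsP.
  exists (L :* y :* ((h * y)^-1 * (g * x))); apply/andP; split.
    apply/imsetP; exists ((h * y)^-1 * (g * x)); last by rewrite /= rcosetE.
    by rewrite mem_ker_div ?groupM.
  apply/set0Pn; exists (g * x).
  by rewrite inE !mem_rcoset mulgK Kg invMg invgK mulKVg mulgK.
case=> _ /andP[/imsetP[v Vv ->] /existsP[_ /andP[/imsetP[w Vw ->]]]].
case/set0Pn=> u; rewrite /= !rcosetE => /setIP[/rcosetP[_ /rcosetP[g Kg ->] ->]].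
case/rcosetP=> _ /rcosetP[h Lh ->] eq_gh.
have [Xg Xh] := (subsetP sKX g Kg, subsetP sLX h Lh).
exists (phi g * phi x); rewrite inE mem_rcoset mulgK mem_morphim //=.
rewrite -morphM // -(mkerr _ Vv) ?groupM // eq_gh mkerr ?groupM // morphM //.
by rewrite mem_rcoset mulgK mem_morphim.
Qed.

Variables (k : map_kind) (G : {group gT}) (a z : gT) (b y : xT).
Hypotheses (rotG : rotary_pair G a z) (rotX : rotary_pair X b y).
Hypotheses (phi_b : phi b = a) (phi_y : phi y = z).

Let Xby : b \in X /\ y \in X := rotary_pair_mem rotX.

Lemma morphim_rotary_pair : phi @* X = G.
Proof.
have [Xb Xy] := Xby; have [<- _] := rotG.
have <- : phi @* <<[set b; y]>> = phi @* X by rewrite (proj1 rotX).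
rewrite morphim_gen ?subUset ?sub1set ?Xb //; congr <<_>>.
by rewrite morphimU !morphim_set1 // phi_b phi_y.
Qed.

Lemma face_stab_sub : face_stab k b y \subset X.
Proof.
case: Xby => Xb Xy; case: k => /=; first by rewrite cycle_subG groupM.
by rewrite gen_subG subUset !sub1set Xy groupJ.
Qed.

Lemma morphim_face_stab : phi @* (face_stab k b y) = face_stab k a z.
Proof.
case: Xby => Xb Xy; case: k => /=.
  by rewrite morphim_cycle ?groupM // morphM // phi_b phi_y.
rewrite morphim_gen ?subUset ?sub1set ?Xy ?groupJ //; congr <<_>>.
by rewrite morphimU !morphim_set1 ?groupJ // morphJ // phi_b phi_y.
Qed.

(** The same function [orbit_image] serves for vertices, edges and faces, because
    the incidence of coset maps is the same relation for all pairs of cells. *)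
Lemma coset_map_cover :
  cover_by X V 'Rs (coset_map k X b y) (coset_map k G a z).
Proof.
case: Xby => Xb Xy; have [sbX syX] : <[b]> \subset X /\ <[y]> \subset X.
  by rewrite !cycle_subG.
have sFX := face_stab_sub; split; first exact: ker_normal.
have cells (K : {group xT}) (K' : {group gT}) :
    K \subset X -> phi @* K = gval K' ->
    {in coset_orbits K &, injective orbit_image} /\
    orbit_image @: coset_orbits K = rcosets K' G.
  by move=> sKX <-; rewrite -morphim_rotary_pair; apply: orbit_image_bij.
exists orbit_image, orbit_image, orbit_image; split.
- by apply: cells; rewrite ?morphim_cycle ?phi_b.
- by apply: cells; rewrite ?morphim_cycle ?phi_y.
- by apply: cells; rewrite ?morphim_face_stab.
by split; apply: orbit_image_inc.
Qed.

End QuotientCosetMap.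
(** * An extension by voltages *)

Section VoltageExtension.
Variables (gT uT : finGroupType).

(** The action of the element of the wreath product with base [c] and top
    component [g]. *)
Definition shift (g : gT) (c : gT -> uT) (x : gT * uT) : gT * uT :=
  (x.1 * g, x.2 * c x.1).

Lemma shift_inj g c : injective (shift g c).
Proof.
by move=> [h i] [h' i'] [/mulIg <- /mulIg <-].
Qed.

Definition shift_perm g c : {perm gT * uT} := perm (@shift_inj g c).

(** The permutations [shift g c], with [g] and [c] read off from the values of
    the permutation at the points [(h, 1)]; this is the wreath product. *)
Definition shifts : {set {perm gT * uT}} :=
  [set s : {perm gT * uT} |
    [forall x, s x == shift (s (1, 1)).1 (fun h => (s (h, 1)).2) x]].

Lemma shiftsP (s : {perm gT * uT}) :
  reflect (exists g c, forall x, s x = shift g c x) (s \in shifts).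
Proof.
rewrite inE; apply: (iffP forallP) => [s_sh | [g [c s_sh]] x].
  by eexists; eexists=> x; apply/eqP/s_sh.
by rewrite /shift /= !s_sh /= !mul1g.
Qed.

Lemma shift_perm_in g c : shift_perm g c \in shifts.
Proof. by apply/shiftsP; exists g, c => x; rewrite permE. Qed.

Lemma shifts_group_set : group_set shifts.
Proof.
apply/group_setP; split.
  by apply/shiftsP; exists 1, (fun=> 1) => -[h i]; rewrite perm1 /shift !mulg1.
move=> s t /shiftsP[g [c s_sh]] /shiftsP[g' [c' t_sh]]; apply/shiftsP.
exists (g * g'), (fun h => c h * c' (h * g)) => x.
by rewrite permM s_sh t_sh /shift /= !mulgA.
Qed.
Canonical shifts_group := Group shifts_group_set.

Definition base_shift (s : {perm gT * uT}) : gT := (s (1, 1)).1.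

Lemma base_shiftE (s : {perm gT * uT}) x :
  s \in shifts -> (s x).1 = x.1 * base_shift s.
Proof. by case/shiftsP=> g [c s_sh]; rewrite /base_shift !s_sh /= mul1g. Qed.

Lemma base_shiftM : {in shifts &, {morph base_shift : s t / s * t}}.
Proof. by move=> s t Ss St; rewrite {1}/base_shift permM base_shiftE. Qed.
Canonical base_shift_morphism := Morphism base_shiftM.

Lemma ker_base_shiftP (s : {perm gT * uT}) : s \in 'ker base_shift ->
  exists c, forall x, s x = (x.1, x.2 * c x.1).
Proof.
case/morphpreP=> /shiftsP[g [c s_sh]] /set1P /=.
rewrite /base_shift s_sh /= mul1g.
by move=> g1; exists c => x; rewrite s_sh g1 /shift mulg1.
Qed.

Hypothesis prime_u : prime #|uT|.

Lemma ker_base_shift_abelem : #|uT|.-abelem ('ker base_shift).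
Proof.
have cUU : abelian [set: uT].
  by apply/cyclic_abelian/prime_cyclic; rewrite cardsT.
apply/(abelemP prime_u); split=> [|s /ker_base_shiftP[c s_c]].
  apply/centsP=> s /ker_base_shiftP[c s_c] t /ker_base_shiftP[d t_d].
  apply/permP=> x; rewrite !permM !(s_c, t_d) /= -!mulgA.
  by rewrite (centsP cUU (c _)) ?inE.
apply/permP=> x; rewrite permX perm1.
have -> n : iter n s x = (x.1, x.2 * c x.1 ^+ n).
  elim: n => [|n IHn]; first by rewrite /= mulg1; case: (x).
  by rewrite iterS IHn s_c /= -mulgA -expgSr.
by rewrite -cardsT expg_cardG ?inE // mulg1; case: (x).
Qed.

Variables (a z : gT) (u : uT).
Hypotheses (a_neq1 : a != 1) (z_order : #[z] = 2) (u_neq1 : u != 1).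

(** The two arcs of an edge must carry inverse voltages for the lift of [z] to be
    an involution.  Concentrating the voltage on one edge reduces the
    nontriviality of the kernel to that edge not being a bridge. *)
Definition voltage (h : gT) : uT :=
  if h == 1 then u else if h == z then u^-1 else 1.
Definition vertex_lift := shift_perm a (fun=> 1).
Definition edge_lift := shift_perm z voltage.
Definition lift_group := <<[set vertex_lift; edge_lift]>>%G.
Local Notation b := vertex_lift.
Local Notation y := edge_lift.
Local Notation X := lift_group.

Let zz1 : z * z = 1.
Proof. by rewrite -[RHS](expg_order z) z_order expgS expg1. Qed.
Let z_neq1 : z != 1. Proof. by rewrite -order_eq1 z_order. Qed.

Lemma lift_group_sub : X \subset shifts.
Proof. by rewrite gen_subG subUset !sub1set !shift_perm_in. Qed.

Definition projection : {morphism X >-> gT} :=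
  [morphism of restrm lift_group_sub base_shift].

Lemma projection_vertex : projection b = a.
Proof. by rewrite /projection /= /restrm /base_shift permE /= mul1g. Qed.

Lemma projection_edge : projection y = z.
Proof. by rewrite /projection /= /restrm /base_shift permE /= mul1g. Qed.

(** The vertex stabilizer does not grow, whence its order stays coprime to that
    of the kernel. *)
Lemma vertex_lift_exp : b ^+ #[a] = 1.
Proof.
apply/permP=> x; rewrite permX perm1.
have -> n : iter n b x = (x.1 * a ^+ n, x.2).
  elim: n => [|n IHn]; first by rewrite /= mulg1; case: (x).
  by rewrite iterS IHn permE /shift /= -mulgA -expgSr mulg1.
by rewrite expg_order mulg1; case: (x).
Qed.

Lemma edge_lift_order : #[y] = 2.
Proof.
apply: nt_prime_order => //.
  apply/permP=> -[h i]; rewrite permX perm1 /= !permE /shift /= -!mulgA zz1 mulg1.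
  rewrite /voltage -[h * z == 1](can_eq (mulgK z)) -mulgA zz1 mulg1 mul1g.
  rewrite -[h * z == z](can_eq (mulgK z)) -mulgA zz1 mulg1.
  have [-> | _] := eqVneq h 1; first by rewrite eq_sym (negPf z_neq1) mulgV mulg1.
  by have [_ | _] := eqVneq h z; rewrite ?mulVg ?mulg1.
apply: contraNneq z_neq1 => y1.
by rewrite -projection_edge y1 morph1.
Qed.

Lemma ker_projection_abelem : #|uT|.-abelem ('ker projection).
Proof.
have kerE : 'ker projection = 'ker_X base_shift by apply: ker_restrm.
by apply: abelemS ker_base_shift_abelem; rewrite /= kerE subsetIr.
Qed.

(** With a trivial kernel, elements of [X] with the same projection agree.  Then
    the arcs [g] with [(g, 1)] in the orbit of [(1, 1)] form a one-edge cut: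
    [(z, u)] is in that orbit, so [(z, 1)] is not, while all edges other than
    the one between [1] and [z] keep the second coordinate. *)
Lemma ker_projection_nontrivial : 'ker projection != 1.
Proof.
have Xb : b \in X by rewrite mem_gen ?set21.
have Xy : y \in X by rewrite mem_gen ?set22.
apply/eqP=> ker1; pose A := [set g | [exists s in X, s (1, 1) == (g, 1)]].
have AP g : reflect (exists2 s, s \in X & s (1, 1) = (g, 1)) (g \in A).
  rewrite inE; apply: (iffP exists_inP) => -[s Xs /eqP];
    by exists s => //; apply/eqP.
apply: (@no_one_edge_cut _ a z a_neq1 zz1 A).
- by apply/AP; exists 1; rewrite ?perm1.
- apply/AP=> -[s Xs s_z]; have Xt : s^-1 * y \in X by rewrite groupM ?groupV.
  have ker_t : s^-1 * y \in 'ker projection.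
    apply/kerP=> //; rewrite morphM ?groupV // morphV // projection_edge.
    by rewrite /projection /= /restrm /base_shift s_z mulVg.
  have: (s^-1 * y) (z, 1) = (z, u).
    by rewrite permM -s_z permK permE /shift /= /voltage eqxx !mul1g.
  move: ker_t; rewrite ker1 => /set1P->; rewrite perm1 => -[/esym/eqP].
  exact/negP.
- move=> g; apply/AP/AP=> -[s Xs s_g].
    exists (s * b^-1); first by rewrite groupM ?groupV.
    apply: (can_inj (permK b)).
    by rewrite permM permKV s_g permE /shift /= !mulg1.
  exists (s * b); first by rewrite groupM.
  by rewrite permM s_g permE /shift /= mulg1.
move=> g /AP[s Xs s_g] g_neq1.
have [-> | g_neqz] := eqVneq g z.
  by apply/AP; exists 1; rewrite ?zz1 ?perm1.
apply/AP; exists (s * y); first by rewrite groupM.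
rewrite permM s_g permE /shift /= /voltage.
by rewrite (negPf g_neq1) (negPf g_neqz) mulg1.
Qed.

End VoltageExtension.

Lemma rotary_pair_abelem_extension (gT : finGroupType) (G : {group gT})
    (a z : gT) (p : nat) :
    prime p -> rotary_pair G a z -> a != 1 ->
  exists (xT : finGroupType) (X : {group xT}) (phi : {morphism X >-> gT})
         (b y : xT),
    [/\ rotary_pair X b y, phi b = a, phi y = z, #[b] %| #[a] &
        p.-abelem ('ker phi) /\ 'ker phi != 1].
Proof.
move=> p_pr [defG z2] a1.
have cardU : #|'F_p| = p := card_Fp p_pr.
have /trivgPn[u _ u1] : [set: 'F_p] != 1.
  by rewrite trivg_card1 cardsT cardU; case: eqP p_pr => // ->.
exists {perm gT * 'F_p}, (@lift_group gT 'F_p a z u).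
exists (@projection gT 'F_p a z u).
exists (@vertex_lift gT 'F_p a), (@edge_lift gT 'F_p z u); split.
- by split=> //; apply: edge_lift_order.
- exact: projection_vertex.
- exact: projection_edge.
- by rewrite order_dvdn vertex_lift_exp.
split; last exact: ker_projection_nontrivial.
have := @ker_projection_abelem gT 'F_p _ a z u; rewrite cardU; exact.
Qed.

(** * Complements *)

(** Any complement [K] of [V] contains a complement [K :&: (V <*> <[b]>)] of [V]
    in [V <*> <[b]>].  There [<[b]>] is also a complement of [V], so the
    two are conjugate under [V]. *)
Lemma complement_containing (gT : finGroupType) (X V : {group gT}) (b : gT) :
    V <| X -> solvable V -> coprime #|V| #|X : V| ->
    b \in X -> coprime #|V| #[b] ->
  exists2 K : {group gT}, V ><| K = X & b \in K.
Proof.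
move=> nsVX solV coVX Xb coVb; have [sVX nVX] := andP nsVX.
have hallV : Hall X V by rewrite /Hall sVX.
have /splitsP[K /complP[TI_VK defX]] := SchurZassenhaus_split hallV nsVX.
have sKX : K \subset X by rewrite -defX mulG_subr.
have nVb : <[b]> \subset 'N(V) by rewrite cycle_subG (subsetP nVX).
pose P := (V <*> <[b]>)%G; have defP : V * <[b]> = P by rewrite /= norm_joinEr.
have sPX : P \subset X by rewrite join_subG sVX cycle_subG.
pose L := (K :&: P)%G.
have defVL : V * L = P.
  by rewrite /= group_modl ?joing_subl // defX (setIidPr sPX).
have TI_VL : V :&: L = 1 by rewrite /= setIA TI_VK setI1g.
have TI_Vb : V :&: <[b]> = 1 by apply: coprime_TIg.
have oL : #|<[b]>| = #|L|.
  apply/eqP; rewrite -(eqn_pmul2l (cardG_gt0 V)) -!TI_cardMg //.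
  by rewrite defP defVL.
have [|||x Vx def_b] := SchurZassenhaus_trans_sol solV _ _ _ oL.
- by apply: subset_trans nVX; apply: subset_trans (subsetIl _ _) sKX.
- by rewrite defVL -defP mulG_subr.
- by rewrite -oL.
have Xx := subsetP sVX x Vx; exists (K :^ x)%G; last first.
  rewrite -cycle_subG def_b conjSg subsetIl //.
rewrite sdprodE /=.
- by rewrite -{1}(conjGid Vx) -conjsMg defX conjGid.
- by apply: subset_trans nVX; rewrite conj_subG.
- by rewrite -{1}(conjGid Vx) -conjIg TI_VK conjs1g.
Qed.

Lemma complement_section (xT gT : finGroupType) (X K : {group xT})
    (G : {group gT}) (phi : {morphism X >-> gT}) :
    'ker phi ><| K = X -> phi @* X = G ->
  exists iota : {morphism G >-> xT},
    [/\ 'injm iota, iota @* G = K, {in G, cancel iota phi} &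
        {in K, cancel phi iota}].
Proof.
move=> defX defG; have [_ mulVK _ TI_VK] := sdprodP defX.
have sKX : K \subset X by rewrite -mulVK mulG_subr.
have inj_psi : 'injm (restrm sKX phi) by rewrite ker_restrm setIC TI_VK.
have im_psi : restrm sKX phi @* K = G.
  have <- : phi @* ('ker phi * K) = G by rewrite mulVK.
  by rewrite morphim_restrm setIid morphimMl ?subsetIl // morphim_ker mul1g.
have sG : G \subset restrm sKX phi @* K by rewrite im_psi.
exists [morphism of restrm sG (invm inj_psi)]; split.
- by rewrite injm_restrm ?injm_invm.
- apply: etrans (im_restrm sG _) (etrans _ (im_invm inj_psi)).
  by congr (invm inj_psi @* _); rewrite im_psi.
- by move=> g /(subsetP sG) /(invmK inj_psi).
- by move=> x /(invmE inj_psi).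
Qed.

(** * Infinitely many covers *)

Unset Implicit Arguments.
Set Strict Implicit.

Theorem theorem1p7 (k : map_kind) (gT : finGroupType) (G H : {group gT})
    (a z : gT) (hM : hall_cayley_map k G H a z) (N : nat) :
  exists (xT : finGroupType) (X V : {group xT})
         (iota : {morphism G >-> xT}) (v : xT),
    [/\ (N < #|V|)%N, is_abelem V, 'injm iota, V ><| (iota @* G) = X & v \in V]
    /\ hall_cayley_map k X (V <*> iota @* H) (iota a) (v * iota z)
    /\ cover_by X V 'Rs (coset_map k X (iota a) (v * iota z))
                        (coset_map k G a z).
Proof.
case: hM => rotG [[V_gt1 F_gt1] _ _ _ _] sHG [defG TI_Ha] coHa.
have [Ga Gz] := rotary_pair_mem rotG.
have a_neq1 : a != 1.
  (* If a = 1, both kinds of face stabilizers contain z and hence G. *)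
  apply: contraTneq F_gt1 => a1; rewrite [_ < _]indexg_gt1 negbK.
  apply: (rotary_pair_sub rotG); first by rewrite a1.
  by case: (k) => /=; rewrite ?a1 ?mul1g ?cycle_id ?mem_gen ?set21.
have [p] := prime_above (maxn N #|G|); rewrite gtn_max => /andP[ltNp ltGp] p_pr.
have [xT [X [phi [b [y]]]]] := rotary_pair_abelem_extension p_pr rotG a_neq1.
case=> rotX phi_b phi_y ob [abelV ntV]; pose V := ('ker phi)%G.
have [Xb Xy] := rotary_pair_mem rotX.
have im_phi : phi @* X = G := morphim_rotary_pair rotG rotX phi_b phi_y.
have pV : p.-group V := abelem_pgroup abelV.
have co_p (K : {group gT}) : K \subset G -> coprime #|V| #|K|.
  move=> sKG; apply: (pnat_coprime pV).
  rewrite p'natE // gtnNdvd //.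
  exact: leq_ltn_trans (subset_leq_card sKG) ltGp.
have coVb : coprime #|V| #[b].
  by apply: coprime_dvdr ob _; apply: co_p; rewrite cycle_subG.
have [K defX Kb] : exists2 K : {group xT}, V ><| K = X & b \in K.
  apply: complement_containing => //; first exact: ker_normal.
    exact: abelian_sol (abelem_abelian abelV).
  by have := card_morphim phi X; rewrite setIid im_phi => <-; apply: co_p.
have [iota [inj_iota im_iota iotaK phiK]] := complement_section defX im_phi.
have iota_a : iota a = b by rewrite -phi_b phiK.
have sKX : K \subset X by have [_ <- _ _] := sdprodP defX; apply: mulG_subr.
have Xiota g : g \in G -> iota g \in X.
  by move=> Gg; rewrite (subsetP sKX) // -im_iota mem_morphim.
exists xT, X, V, iota, (y * (iota z)^-1); rewrite mulgKV iota_a.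
split; last split; last exact: coset_map_cover.
- split=> //.
  + apply: leq_trans ltNp (dvdn_leq (cardG_gt0 _) _).
    by have [] := pgroup_pdiv pV ntV.
  + by apply/is_abelemP; exists p.
  + by rewrite im_iota.
  apply/kerP; first by rewrite groupM ?groupV ?Xiota.
  by rewrite morphM ?groupV ?morphV ?Xiota // phi_y iotaK // mulgV.
have sHX : iota @* H \subset X.
  by apply: subset_trans (morphimS _ sHG) _; rewrite im_iota.
have nVH : iota @* H \subset 'N(V) by apply: subset_trans sHX (ker_norm phi).
have oVH : #|V <*> iota @* H| = (#|V| * #|H|)%N.
  have oH : #|iota @* H| = #|H| by rewrite card_injm.
  rewrite norm_joinEr // TI_cardMg /= ?oH //.
  by apply: coprime_TIg; rewrite /= oH co_p.
have co_VHb : coprime #|V <*> iota @* H| #[b].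
  by rewrite oVH coprimeMl coVb /= (coprime_dvdr ob).
split=> //.
- have index_gt1 (L : {group xT}) (L' : {group gT}) :
      phi @* L = L' -> (1 < #|G : L'|)%N -> (1 < #|X : L|)%N.
    move=> defL'; rewrite !indexg_gt1; apply: contra => /(morphimS phi).
    by rewrite im_phi defL'.
  apply: coset_map_vertex_rotary => //.
    by apply: index_gt1 V_gt1; rewrite morphim_cycle ?phi_b.
  by apply: index_gt1 F_gt1; apply: (morphim_face_stab _ rotX phi_b phi_y).
- by rewrite join_subG sHX normal_sub ?ker_normal.
split; last exact: coprime_TIg.
by rewrite /= norm_joinEr // -mulgA -iota_a -morphim_cycle // -morphimMl // defG
  im_iota; case/sdprodP: defX.
Qed.
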